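(* For every $n\geq 1$, the recurrent domino problem $\mathrm{RDP}(\mathbb F_n)$ on the free group $\mathbb F_n$ on $n$ generators is decidable.
   Context: Let $G$ be a finitely generated group and $S$ a finite generating set of $G$. For a finite alphabet $A$, a nearest neighbor pattern is a tuple $(a,b,s)$ with $a,b\in A$, $s\in S$; it appears in $x\in A^G$ if there is $g\in G$ with $x(g)=a$ and $x(gs)=b$. For a finite set $\mathcal F$ of nearest neighbor patterns, $X_{\mathcal F}\subseteq A^G$ is the set of configurations $x:G\to A$ in which no pattern of $\mathcal F$ appears. Recurrent domino problem $\mathrm{RDP}(G,S)$: given a finite alphabet $A$, a finite set $\mathcal F$ of nearest neighbor forbidden patterns and a letter $a_0\in A$, determine whether there is $x\in X_{\mathcal F}$ such that $\{g\in G: x(g)=a_0\}$ is infinite. $\mathrm{RDP}(G)$ denotes $\mathrm{RDP}(G,S)$ for an arbitrary finite generating set $S$ (decidability does not depend on the choice of $S$). *)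

(* Defs.v *)
From HB Require Import structures.
From mathcomp Require Import all_boot.
From mathcomp Require Import all_classical.

Set Implicit Arguments.
Unset Strict Implicit.
Unset Printing Implicit Defensive.

Local Open Scope group_scope.
Local Open Scope classical_set_scope.

(* Kleene's mu-recursive functions.  Arities are not tracked: a program takes a
   list of naturals, and the projections (and the successor) read a missing
   argument as 0. *)
Inductive recfun : Type :=
| RZero
| RSucc
| RProj of nat
| RComp of recfun & seq recfun
| RPrec of recfun & recfun
| RMu of recfun.

(* [reval f xs y]: the program f halts on the arguments xs, with value y. *)
Inductive reval : recfun -> seq nat -> nat -> Prop :=
| reval_zero xs : reval RZero xs 0
| reval_succ xs : reval RSucc xs (nth 0 xs 0).+1
| reval_proj i xs : reval (RProj i) xs (nth 0 xs i)
| reval_comp f gs xs ys y :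
    revals gs xs ys -> reval f ys y -> reval (RComp f gs) xs y
| reval_prec0 f g xs y :
    reval f xs y -> reval (RPrec f g) (0 :: xs) y
| reval_precS f g n xs z y :
    reval (RPrec f g) (n :: xs) z -> reval g [:: n, z & xs] y ->
    reval (RPrec f g) (n.+1 :: xs) y
| reval_mu f n xs (v : nat -> nat) :
    (forall i, (i < n)%N -> reval f (i :: xs) (v i).+1) ->
    reval f (n :: xs) 0 -> reval (RMu f) xs n
with revals : seq recfun -> seq nat -> seq nat -> Prop :=
| revals_nil xs : revals [::] xs [::]
| revals_cons g gs xs y ys :
    reval g xs y -> revals gs xs ys -> revals (g :: gs) xs (y :: ys).

Scheme reval_mut := Minimality for reval Sort Prop
  with revals_mut := Minimality for revals Sort Prop.

Lemma reval_inj f xs y1 y2 : reval f xs y1 -> reval f xs y2 -> y1 = y2.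
Proof.
move=> h1; move: f xs y1 h1 y2.
apply: (@reval_mut (fun f xs y1 => forall y2, reval f xs y2 -> y1 = y2)
  (fun gs xs ys1 => forall ys2, revals gs xs ys2 -> ys1 = ys2)).
- by move=> xs y2 h; inversion h.
- by move=> xs y2 h; inversion h.
- by move=> i xs y2 h; inversion h.
- move=> f gs xs ys y _ IHgs _ IHf y2 h; inversion h; subst.
  by apply: IHf; rewrite (IHgs _ H1).
- by move=> f g xs y _ IH y2 h; inversion h; subst; apply: IH.
- move=> f g n xs z y _ IHr _ IHg y2 h; inversion h; subst.
  by apply: IHg; rewrite (IHr _ H4).
- move=> f n xs v _ IHv _ IH0 y2 h; inversion h; subst.
  case: (ltngtP n y2) => // [lt_n | lt_y2].
  + by have := IH0 _ (H0 _ lt_n).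
  + by have := IHv _ lt_y2 _ H1.
- by move=> xs ys2 h; inversion h.
- move=> g gs xs y ys _ IHg _ IHgs ys2 h; inversion h; subst.
  by congr cons; [apply: IHg | apply: IHgs].
Qed.

Definition decidable_problem (X : Type) (enc : X -> nat) (P : X -> Prop) : Prop :=
  exists f : recfun, forall I : X,
    (P I -> reval f [:: enc I] 1) /\ (~ P I -> reval f [:: enc I] 0).

Definition generates (G : groupType) (S : seq G) : Prop :=
  forall H : {pred G}, group_closed H -> {subset S <= H} -> forall g, g \in H.

Section Domino.
Variables (G : groupType) (S : seq G).

Definition nn_pattern (A : Type) : Type := (A * A * seq_sub S)%type.

Definition appears (A : Type) (p : nn_pattern A) (x : G -> A) : Prop :=
  let: (a, b, s) := p in exists g : G, x g = a /\ x (g * ssval s) = b.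

Definition nn_subshift (A : eqType) (F : seq (nn_pattern A)) : set (G -> A) :=
  [set x | forall p, p \in F -> ~ appears p x].

(* The finite alphabet is, up to renaming its letters, {0, ..., m - 1}; the
   finite set of forbidden patterns is given by a list enumerating it. *)
Record rdp_instance : Type := RdpInstance {
  alphabet_size : nat;
  forbidden : seq (nn_pattern 'I_alphabet_size);
  letter : 'I_alphabet_size
}.

Definition rdp (I : rdp_instance) : Prop :=
  exists2 x, nn_subshift (forbidden I) x &
    infinite_set [set g : G | x g = letter I].

(* [CodeSeq.code] is an effective bijection from seq nat to nat; an element of S
   is represented by its position in the list S. *)
Definition rdp_code (I : rdp_instance) : nat :=
  CodeSeq.code [:: alphabet_size I, nat_of_ord (letter I) &
    flatten [seq [:: nat_of_ord p.1.1; nat_of_ord p.1.2; index (ssval p.2) S]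
            | p <- forbidden I]].

Lemma rdp_code_inj : injective rdp_code.
Proof.
move=> [m F a] [m' F' a'] /(can_inj CodeSeq.codeK) /= [em].
subst m' => /ord_inj ea eF; subst a'; congr RdpInstance.
elim: F F' eF => [|[[x y] s] F IH] [|[[x' y'] s'] F'] //=.
case=> /ord_inj-> /ord_inj-> /(index_inj 1) es /IH->; congr (_ :: _).
by congr (_, _); apply: val_inj; apply: es; apply: ssvalP.
Qed.

Definition rdp_decidable : Prop := decidable_problem rdp_code rdp.

End Domino.

Section FreeGroup.
Variable n : nat.

(* (i, false) is the i-th free generator and (i, true) is its inverse. *)
Definition flet : Type := ('I_n * bool)%type.

Definition flet_inv (a : flet) : flet := (a.1, ~~ a.2).

Definition reduced (w : seq flet) : bool :=
  sorted (fun a b => b != flet_inv a) w.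

Record free_group := FreeGroup { fword :> seq flet; fwordP : reduced fword }.

HB.instance Definition _ := [isSub for fword].
HB.instance Definition _ := [Choice of free_group by <:].

Definition fpush (a : flet) (w : seq flet) : seq flet :=
  if w is b :: w' then if b == flet_inv a then w' else a :: w else [:: a].

(* The reduced form of the concatenation u ++ v, for v reduced. *)
Definition fcat (u v : seq flet) : seq flet := foldr fpush v u.

Lemma flet_invK : involutive flet_inv.
Proof. by case=> i b; rewrite /flet_inv /= negbK. Qed.

Lemma reduced_cons a w : reduced (a :: w) -> reduced w.
Proof. by case: w => //= b w /andP[]. Qed.

Lemma fpush_cons a w : reduced (a :: w) -> fpush a w = a :: w.
Proof. by case: w => //= b w /andP[/negPf->]. Qed.

Lemma fpush_reduced a w : reduced w -> reduced (fpush a w).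
Proof.
case: w => //= b w rw; case: ifPn => [_|ne]; first exact: (@reduced_cons b).
by rewrite /= ne.
Qed.

Lemma fcat_reduced u v : reduced v -> reduced (fcat u v).
Proof. by move=> rv; elim: u => //= a u; apply: fpush_reduced. Qed.

Lemma fpushK a w : reduced w -> fpush (flet_inv a) (fpush a w) = w.
Proof.
case: w => [|b w] rw /=; first by rewrite flet_invK eqxx.
case: eqP => [eb|_] /=; last by rewrite flet_invK eqxx.
by rewrite -eb fpush_cons.
Qed.

Lemma fcat_push a u v : reduced v -> fcat (fpush a u) v = fpush a (fcat u v).
Proof.
move=> rv; case: u => //= b u; case: eqP => //= ->.
by have := fpushK (flet_inv a) (fcat_reduced u rv); rewrite flet_invK.
Qed.

Lemma fcatA u v w : reduced w -> fcat u (fcat v w) = fcat (fcat u v) w.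
Proof. by move=> rw; elim: u => //= a u ->; rewrite fcat_push. Qed.

Lemma fcat0 u : reduced u -> fcat u [::] = u.
Proof.
elim: u => //= a u IH ru; rewrite IH; last exact: reduced_cons ru.
exact: fpush_cons.
Qed.

Lemma rev_reduced u : reduced u -> reduced (rev (map flet_inv u)).
Proof.
rewrite /reduced rev_sorted sorted_map; apply: sub_sorted => a b /=.
by rewrite flet_invK eq_sym.
Qed.

Lemma fcat_rev u v : reduced v -> fcat (rev (map flet_inv u)) (fcat u v) = v.
Proof.
elim: u v => //= a u IH v rv.
rewrite rev_cons -cats1 /fcat foldr_cat /= fpushK; first exact: IH.
exact: fcat_reduced.
Qed.

Definition fone : free_group := @FreeGroup [::] isT.
Definition fmul (u v : free_group) : free_group :=
  FreeGroup (fcat_reduced u (fwordP v)).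
Definition finv (u : free_group) : free_group :=
  FreeGroup (rev_reduced (fwordP u)).

Lemma fmulA : associative fmul.
Proof. by move=> u v w; apply: val_inj; rewrite /= fcatA ?fwordP. Qed.
Lemma fmul1 : left_id fone fmul.
Proof. by move=> u; apply: val_inj. Qed.
Lemma fmulr1 : right_id fone fmul.
Proof. by move=> u; apply: val_inj; rewrite /= fcat0 ?fwordP. Qed.
Lemma fmulV : left_inverse fone finv fmul.
Proof.
by move=> u; apply: val_inj; rewrite /= -{2}(fcat0 (fwordP u)) fcat_rev.
Qed.
Lemma fmulrV : right_inverse fone finv fmul.
Proof.
move=> u; rewrite -[LHS]fmul1 -{1}(fmulV (finv u)) -fmulA (fmulA (finv u)).
by rewrite fmulV fmul1 fmulV.
Qed.

HB.instance Definition _ :=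
  isGroup.Build free_group fmulA fmul1 fmulr1 fmulV fmulrV.

Definition fgen (i : 'I_n) : free_group := @FreeGroup [:: (i, false)] isT.

Lemma mulg_fgenE i (w : seq flet) (rw : reduced w) (riw : reduced ((i, false) :: w)) :
  FreeGroup riw = fgen i * FreeGroup rw.
Proof. by apply: val_inj; rewrite /= fpush_cons. Qed.

Lemma mulg_fgenVE i (w : seq flet) (rw : reduced w) (riw : reduced ((i, true) :: w)) :
  FreeGroup riw = (fgen i)^-1 * FreeGroup rw.
Proof. by apply: val_inj; rewrite /= fpush_cons. Qed.

Lemma generates_fgen : generates [seq fgen i | i <- enum 'I_n].
Proof.
move=> H Hgrp SH [w rw].
have Hgen i : fgen i \in H by apply/SH/map_f; rewrite mem_enum.
elim: w rw => [rw|[i b] w IH riw].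
  by rewrite [FreeGroup _](_ : _ = 1) ?Hgrp.1 //; apply: val_inj.
have rw := reduced_cons riw; case: b riw => riw.
  rewrite (mulg_fgenVE rw); apply: group_closedM => //.
  exact: (group_closedV Hgrp).
by rewrite (mulg_fgenE rw); apply: group_closedM.
Qed.

Lemma free_group_lift (H : groupType) (f : 'I_n -> H) :
  exists phi : free_group -> H,
    {morph phi : x y / x * y} /\ (forall i, phi (fgen i) = f i).
Proof.
pose h (a : flet) := if a.2 then (f a.1)^-1 else f a.1.
pose ev := foldr (fun a g => h a * g) 1.
have hV a : h (flet_inv a) = (h a)^-1.
  by case: a => i [] /=; rewrite /h /= ?invgK.
have ev_push a w : ev (fpush a w) = h a * ev w.
  by case: w => //= b w; case: eqP => //= ->; rewrite hV mulVKg.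
exists ev; split=> [[u ru] [v rv]|i]; last by rewrite /ev /= mulg1.
rewrite /=; elim: u {ru} => [|a u IH] /=; first by rewrite mul1g.
by rewrite ev_push IH mulgA.
Qed.

End FreeGroup.

(* Main.v *)
Require Import Defs.
From mathcomp Require Import all_boot.
From mathcomp Require Import all_classical.

(* Let W be a finite suffix-closed subset of the free group containing 1 and S.
   Recording at g the pattern of a configuration on gW turns the given subshift
   into a nearest neighbor subshift for the free generators, over an alphabet of
   patterns q < m ^ |W|, with a set of marked letters in place of a_0.

   On the tree, let a state be a letter together with the last direction read.
   A configuration with infinitely many marked vertices exists iff, inside a set
   of letters V each of which extends in every direction, some state s lies on a
   cycle and a marked letter can be reached from s by a path that leaves the
   cycle at s (or s is itself marked).  Unrolling the cycle and branching off at
   each passage through s gives one direction.  Conversely, below a vertex with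
   infinitely many marked descendants, one always finds a vertex of the same
   kind from which a path to a marked vertex forks away from an infinite
   subtree; two such vertices on a ray have the same state.

   Reachability is expressed by quantifying over all sets of states closed under
   the transitions.  With sets coded as bitmasks, the criterion becomes an
   arithmetical formula with computably bounded quantifiers only. *)

Set Implicit Arguments.
Unset Strict Implicit.
Unset Printing Implicit Defensive.

(** * Total computable functions *)

(* Arguments are lists of a fixed length k, since a program cannot pass on an
   argument list of unknown length to a subprogram. *)
Definition computable (k : nat) (f : seq nat -> nat) : Prop :=
  exists p, forall xs, size xs = k -> reval p xs (f xs).

Lemma comp_ext k f g : f =1 g -> computable k f -> computable k g.
Proof. by move=> /funext ->. Qed.

Lemma comp_const k c : computable k (fun=> c).
Proof.
elim: c => [|c [p hp]]; first by exists RZero => xs _; apply: reval_zero.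
exists (RComp RSucc [:: p]) => xs hxs.
apply: (@reval_comp _ _ _ [:: c]); last exact: (reval_succ [:: c]).
by apply: revals_cons; [apply: hp | apply: revals_nil].
Qed.

Lemma comp_nth k i : computable k (fun xs => nth 0 xs i).
Proof. by exists (RProj i) => xs _; apply: reval_proj. Qed.

(** A list of projections is how a program hands its own arguments on to a subprogram. *)
Lemma revals_proj xs i :
  revals [seq RProj j | j <- iota i (size xs - i)] xs (drop i xs).
Proof.
have [k hk] : exists k, size xs - i = k by exists (size xs - i).
elim: k i hk => [|k IH] i hk.
  rewrite hk drop_oversize; first exact: revals_nil.
  by rewrite -subn_eq0 hk.
have lt_i : i < size xs by rewrite -subn_gt0 hk.
rewrite hk /= (drop_nth 0 lt_i).
apply: revals_cons; first exact: reval_proj.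
have e : size xs - i.+1 = k by rewrite subnS hk.
by rewrite -[k in iota _ k]e; apply: IH.
Qed.

Lemma comp_tail k f : computable k f -> computable k.+1 (fun xs => f (behead xs)).
Proof.
case=> p hp; exists (RComp p [seq RProj j | j <- iota 1 k]) => xs hxs.
apply: (@reval_comp _ _ _ (behead xs)); last by apply: hp; rewrite size_behead hxs.
have := revals_proj xs 1; rewrite drop1 hxs subn1; apply.
Qed.

(** The single place where primitive recursion is used: arithmetic, counting and iterated decoding
    are instances. The loop body sees the counter and the current value as its first two
    arguments. *)
Lemma comp_iteri k e f (h : seq nat -> nat -> nat -> nat) :
  computable k e -> computable k f ->
  computable k.+2 (fun ys => h (behead (behead ys)) (nth 0 ys 0) (nth 0 ys 1)) ->
  computable k (fun xs => iteri (e xs) (h xs) (f xs)).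
Proof.
move=> [pe he] [pf hf] [ph hh].
exists (RComp (RPrec pf ph) (pe :: [seq RProj j | j <- iota 0 k])) => xs hxs.
apply: (@reval_comp _ _ _ (e xs :: xs)).
  apply: revals_cons; first exact: he.
  by have := revals_proj xs 0; rewrite subn0 drop0 hxs.
elim: (e xs) => [|i IH]; first by apply: reval_prec0; apply: hf.
apply: reval_precS IH _.
by apply: (hh [:: i, iteri i (h xs) (f xs) & xs]); rewrite /= hxs.
Qed.

Lemma comp_succ k f : computable k f -> computable k (fun xs => (f xs).+1).
Proof.
move=> [p hp]; exists (RComp RSucc [:: p]) => xs hxs.
apply: (@reval_comp _ _ _ [:: f xs]); last exact: (reval_succ [:: f xs]).
by apply: revals_cons; [apply: hp | apply: revals_nil].
Qed.

Lemma comp_pred k f : computable k f -> computable k (fun xs => (f xs).-1).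
Proof.
(* The last counter value of a loop of length [n] is [n.-1]; for [n = 0] the initial value 0 is
   returned. *)
move=> hf; have := comp_iteri (h := fun _ i _ => i) hf (comp_const k 0) (comp_nth _ 0).
by apply: comp_ext => xs; case: (f xs).
Qed.

Section Arithmetic.
Variables (k : nat) (f g : seq nat -> nat).
Hypotheses (hf : computable k f) (hg : computable k g).

Lemma comp_add : computable k (fun xs => f xs + g xs).
Proof.
have := comp_iteri (h := fun _ _ z => z.+1) hf hg (comp_succ (comp_nth _ 1)).
by apply: comp_ext => xs; elim: (f xs) => //= i ->.
Qed.

Lemma comp_sub : computable k (fun xs => f xs - g xs).
Proof.
have := comp_iteri (h := fun _ _ z => z.-1) hg hf (comp_pred (comp_nth _ 1)).
by apply: comp_ext => xs; elim: (g xs) => [|i /= ->]; rewrite ?subn0 ?subnS.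
Qed.
End Arithmetic.

Lemma comp_mul k f g : computable k f -> computable k g -> computable k (fun xs => f xs * g xs).
Proof.
move=> hf hg.
have := comp_iteri (h := fun xs _ z => g xs + z) hf (comp_const k 0)
  (comp_add (comp_tail (comp_tail hg)) (comp_nth _ 1)).
by apply: comp_ext => xs; elim: (f xs) => //= i ->.
Qed.

Lemma comp_exp k f g : computable k f -> computable k g -> computable k (fun xs => f xs ^ g xs).
Proof.
move=> hf hg.
have := comp_iteri (h := fun xs _ z => f xs * z) hg (comp_const k 1)
  (comp_mul (comp_tail (comp_tail hf)) (comp_nth _ 1)).
by apply: comp_ext => xs; elim: (g xs) => //= i ->; rewrite expnS.
Qed.

Lemma comp_negb k (b : seq nat -> bool) :
  computable k (fun xs => b xs) -> computable k (fun xs => ~~ b xs).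
Proof.
move=> hb; apply: comp_ext (comp_sub (comp_const k 1) hb) => xs.
by case: (b xs).
Qed.

Lemma comp_andb k (b c : seq nat -> bool) :
  computable k (fun xs => b xs) -> computable k (fun xs => c xs) ->
  computable k (fun xs => b xs && c xs).
Proof.
by move=> hb hc; apply: comp_ext (comp_mul hb hc) => xs; rewrite mulnb.
Qed.

Lemma comp_orb k (b c : seq nat -> bool) :
  computable k (fun xs => b xs) -> computable k (fun xs => c xs) ->
  computable k (fun xs => b xs || c xs).
Proof.
move=> hb hc.
apply: comp_ext (comp_negb (comp_andb (comp_negb hb) (comp_negb hc))) => xs.
by rewrite negb_and !negbK.
Qed.

Lemma comp_implyb k (b c : seq nat -> bool) :
  computable k (fun xs => b xs) -> computable k (fun xs => c xs) ->
  computable k (fun xs => b xs ==> c xs).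
Proof.
move=> hb hc; apply: comp_ext (comp_orb (comp_negb hb) hc) => xs.
by rewrite implybE.
Qed.

Lemma comp_eq0 k f : computable k f -> computable k (fun xs => f xs == 0).
Proof.
move=> hf; apply: comp_ext (comp_sub (comp_const k 1) hf) => xs.
by case: (f xs).
Qed.

Lemma comp_leq k f g : computable k f -> computable k g -> computable k (fun xs => f xs <= g xs).
Proof. by move=> hf hg; apply: comp_eq0 (comp_sub hf hg). Qed.

Lemma comp_eq k f g : computable k f -> computable k g -> computable k (fun xs => f xs == g xs).
Proof.
move=> hf hg; apply: comp_ext (comp_andb (comp_leq hf hg) (comp_leq hg hf)) => xs.
by rewrite eqn_leq.
Qed.

(* The bound variable is the head of the extended argument list. *)
Section BoundedQuantifiers.
Variables (k : nat) (e : seq nat -> nat) (P : seq nat -> nat -> bool).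
Hypotheses (he : computable k e)
  (hP : computable k.+1 (fun ys => P (behead ys) (nth 0 ys 0))).

Lemma comp_count : computable k (fun xs => count (P xs) (iota 0 (e xs))).
Proof.
(* The loop body has the running count as an extra second argument; the projections skip it before
   [P] is evaluated. *)
have hP2 : computable k.+2 (fun ys => P (behead (behead ys)) (nth 0 ys 0)).
  case: hP => p hp.
  exists (RComp p (RProj 0 :: [seq RProj j | j <- iota 2 k])) => xs hxs.
  apply: (@reval_comp _ _ _ (nth 0 xs 0 :: behead (behead xs))).
    apply: revals_cons; first exact: reval_proj.
    have := revals_proj xs 2.
    by rewrite hxs subn2 -[drop 2 xs]/(drop (1 + 1) xs) -drop_drop !drop1.
  by apply: (hp (_ :: _)) => /=; rewrite !size_behead hxs.
have := comp_iteri (h := fun xs i z => z + P xs i) he (comp_const k 0)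
  (comp_add (comp_nth _ 1) hP2).
apply: comp_ext => xs; elim: (e xs) => // i IH.
by rewrite -addn1 iotaD count_cat /= addn1 /= IH addn0.
Qed.

Lemma comp_all : computable k (fun xs => all (P xs) (iota 0 (e xs))).
Proof.
apply: comp_ext (comp_eq comp_count he) => xs.
by rewrite all_count size_iota.
Qed.

Lemma comp_has : computable k (fun xs => has (P xs) (iota 0 (e xs))).
Proof.
apply: comp_ext (comp_leq (comp_const k 1) comp_count) => xs.
by rewrite has_count.
Qed.
End BoundedQuantifiers.

(** The list is fixed in advance, so the conjunction is unrolled into the program and the entries
    need no coding. *)
Lemma comp_all_const k (U : Type) (l : seq U) (P : U -> seq nat -> bool) :
  (forall u, computable k (fun xs => P u xs)) ->
  computable k (fun xs => all (fun u => P u xs) l).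
Proof.
move=> hP; elim: l => [|u l IH]; first exact: comp_const.
exact: comp_andb.
Qed.

(** Turns a threshold into a value: quotients and 2-adic valuations are computed by counting the
    indices below them. *)
Lemma count_iota_lt n q : q <= n -> count (fun i => i < q) (iota 0 n) = q.
Proof.
move=> le_qn; rewrite -(subnKC le_qn) iotaD count_cat.
rewrite (_ : count _ _ = q) => [|]; last first.
  rewrite -[RHS](size_iota 0); apply/eqP; rewrite -all_count.
  by apply/allP => i; rewrite mem_iota.
rewrite -[RHS]addn0; congr (_ + _); apply/eqP.
rewrite -leqn0 leqNgt -has_count; apply/hasPn => i.
by rewrite mem_iota -leqNgt => /andP[].
Qed.

(** Hypotheses about outer arguments are weakened once for each bound variable crossed, hence the
    iterated [comp_tail]. *)
Ltac computable_rule :=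
  match goal with
  | H : computable ?k _ |- computable ?k _ => exact H
  | H : computable _ _ |- computable _ _ => exact (comp_tail H)
  | H : computable _ _ |- computable _ _ => exact (comp_tail (comp_tail H))
  | H : computable _ _ |- computable _ _ => exact (comp_tail (comp_tail (comp_tail H)))
  | H : computable _ _ |- computable _ _ =>
      exact (comp_tail (comp_tail (comp_tail (comp_tail H))))
  | |- computable _ (fun xs => nth 0 xs _) => exact (comp_nth _ _)
  | |- computable _ (fun xs => nth 0 (behead xs) _) => exact (comp_tail (comp_nth _ _))
  | |- computable _ (fun xs => nth 0 (behead (behead xs)) _) =>
      exact (comp_tail (comp_tail (comp_nth _ _)))
  | |- computable _ (fun xs => nth 0 (behead (behead (behead xs))) _) =>
      exact (comp_tail (comp_tail (comp_tail (comp_nth _ _))))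
  | |- computable _ (fun xs => ?c) => exact (comp_const _ c)
  | |- computable _ (fun xs => _ + _) => apply: comp_add
  | |- computable _ (fun xs => _ - _) => apply: comp_sub
  | |- computable _ (fun xs => _ * _) => apply: comp_mul
  | |- computable _ (fun xs => _ ^ _) => apply: comp_exp
  | |- computable _ (fun xs => _.-1) => apply: comp_pred
  | |- computable _ (fun xs => nat_of_bool (~~ _)) => apply: comp_negb
  | |- computable _ (fun xs => nat_of_bool (_ && _)) => apply: comp_andb
  | |- computable _ (fun xs => nat_of_bool (_ || _)) => apply: comp_orb
  | |- computable _ (fun xs => nat_of_bool (_ ==> _)) => apply: comp_implyb
  | |- computable _ (fun xs => nat_of_bool (_ == _)) => apply: comp_eq
  | |- computable _ (fun xs => nat_of_bool (_ <= _)) => apply: comp_leq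
  | |- computable _ (fun xs => nat_of_bool (all _ (iota 0 _))) => apply: comp_all
  | |- computable _ (fun xs => nat_of_bool (has _ (iota 0 _))) => apply: comp_has
  | |- computable _ (fun xs => nat_of_bool (all _ _)) =>
      apply: comp_all_const => ?
  | |- computable _ (fun xs => count _ (iota 0 _)) => apply: comp_count
  | |- computable _ (fun xs => _.+1) => apply: comp_succ
  end.
Ltac solve_computable := intros; repeat computable_rule.

(** The guard [0 < d] reproduces the convention that division by 0 yields 0. *)
Lemma divn_count n d :
  n %/ d = count (fun i => (0 < d) && (i.+1 * d <= n)) (iota 0 n).
Proof.
case: d => [|d]; first by rewrite divn0; elim: (iota 0 n).
rewrite -[LHS](count_iota_lt (leq_div n d.+1)).
by apply: eq_count => i /=; rewrite leq_divRL.
Qed.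

Lemma comp_div k f g : computable k f -> computable k g -> computable k (fun xs => f xs %/ g xs).
Proof.
move=> hf hg; apply: comp_ext => [xs|]; first exact/esym/divn_count.
by solve_computable.
Qed.

Lemma comp_mod k f g : computable k f -> computable k g -> computable k (fun xs => f xs %% g xs).
Proof.
move=> hf hg.
apply: comp_ext (comp_sub hf (comp_mul (comp_div hf hg) hg)) => xs.
by rewrite {1}(divn_eq (f xs) (g xs)) addKn.
Qed.

(** A fixed table is read by nested case distinctions, each branch being selected by multiplication
    with the truth value of its test. *)
Lemma comp_nth_const k l f : computable k f -> computable k (fun xs => nth 0 l (f xs)).
Proof.
elim: l f => [|a l IH] f hf.
  by apply: comp_ext (comp_const k 0) => xs; rewrite nth_nil.
apply: comp_ext (comp_add (comp_mul (comp_eq0 hf) (comp_const k a))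
  (comp_mul (comp_negb (comp_eq0 hf)) (IH _ (comp_pred hf)))) => xs.
by case: (f xs) => [|i] /=; rewrite ?mul1n ?addn0.
Qed.

(* [CodeSeq.code (a :: s) = 2 ^ a * (2 * CodeSeq.code s + 1)], so the head is the
   2-adic valuation. *)
Definition code_head (x : nat) : nat :=
  count (fun i => x %% 2 ^ i.+1 == 0) (iota 0 x).

Definition code_tail (x : nat) : nat := (x %/ 2 ^ code_head x).-1 %/ 2.

Definition code_drop (x k : nat) : nat := iter k code_tail x.

Definition code_nth (x k : nat) : nat := code_head (code_drop x k).

Lemma comp_code_head k f : computable k f -> computable k (fun xs => code_head (f xs)).
Proof.
move=> hf; apply: comp_count => //; apply: comp_eq; last exact: comp_const.
by apply: comp_mod; solve_computable.
Qed.

Lemma comp_code_tail k f : computable k f -> computable k (fun xs => code_tail (f xs)).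
Proof.
move=> hf; have := comp_code_head hf; rewrite /code_tail => hh.
apply: comp_div (comp_const k 2); apply: comp_pred; apply: comp_div => //.
by solve_computable.
Qed.

Lemma comp_code_drop k f g :
  computable k f -> computable k g -> computable k (fun xs => code_drop (f xs) (g xs)).
Proof.
move=> hf hg.
have := comp_iteri (h := fun _ _ z => code_tail z) hg hf
  (comp_code_tail (comp_nth _ 1)).
by apply: comp_ext => xs; rewrite /code_drop; elim: (g xs) => //= i ->.
Qed.

Lemma comp_code_nth k f g :
  computable k f -> computable k g -> computable k (fun xs => code_nth (f xs) (g xs)).
Proof. by move=> hf hg; apply/comp_code_head/comp_code_drop. Qed.

Lemma code_head_cons a s : code_head (CodeSeq.code (a :: s)) = a.
Proof.
rewrite /code_head /=; set y := CodeSeq.code s.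
have le_a : a <= 2 ^ a * y.*2.+1.
  by rewrite (leq_trans (ltnW (ltn_expl a (isT : 1 < 2)))) // leq_pmulr.
rewrite -[RHS](count_iota_lt le_a); apply: eq_count => i.
rewrite -/(dvdn _ _); apply/idP/idP => [|lt_ia]; last first.
  exact: dvdn_trans (dvdn_exp2l 2 lt_ia) (dvdn_mulr _ (dvdnn _)).
rewrite Gauss_dvdl ?dvdn_Pexp2l //.
by rewrite coprimeXl // coprime2n /= odd_double.
Qed.

Lemma code_tail_cons a s : code_tail (CodeSeq.code (a :: s)) = CodeSeq.code s.
Proof.
rewrite /code_tail code_head_cons /= mulKn ?expn_gt0 //=.
by rewrite -muln2 mulnK.
Qed.

Lemma code_dropE s k : code_drop (CodeSeq.code s) k = CodeSeq.code (drop k s).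
Proof.
elim: k s => [|k IH] [|a s] //.
  (* Past the end of the list: 0 codes the empty list and is a fixed point of [code_tail]. *)
  by rewrite /code_drop; elim: k {IH} => //= k ->.
by rewrite /code_drop iterSr code_tail_cons; apply: IH.
Qed.

Lemma code_nthE s k : code_nth (CodeSeq.code s) k = nth 0 s k.
Proof.
rewrite /code_nth code_dropE; case: (ltnP k (size s)) => hk.
  by rewrite (drop_nth 0) // code_head_cons.
by rewrite drop_oversize // nth_default.
Qed.

(** Only the empty list has code 0, which gives an arithmetical test for the end of the list. *)
Lemma code_drop_eq0 s k : (code_drop (CodeSeq.code s) k == 0) = (size s <= k).
Proof.
rewrite code_dropE; case: (ltnP k (size s)) => hk; last by rewrite drop_oversize.
by rewrite (drop_nth 0) //= muln_eq0 expn_eq0.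
Qed.

(** Makes the code itself a valid bound for loops over the coded list. *)
Lemma size_code s : size s <= CodeSeq.code s.
Proof.
elim: s => //= a s IH; rewrite (leq_ltn_trans IH) //.
apply: leq_trans (leq_pmull _ _); last by rewrite expn_gt0.
by rewrite ltnS -addnn leq_addr.
Qed.

(** A number below [m ^ K] represents a map from [K] positions to [m] letters through its digits in
    base [m]. *)
Definition digit (m q i : nat) : nat := (q %/ m ^ i) %% m.

Definition bit (u i : nat) : bool := digit 2 u i == 1.

Lemma comp_digit k f g h : computable k f -> computable k g -> computable k h ->
  computable k (fun xs => digit (f xs) (g xs) (h xs)).
Proof.
by move=> hf hg hh; exact: comp_mod (comp_div hg (comp_exp hf hh)) hf.
Qed.

Lemma comp_bit k f g : computable k f -> computable k g ->
  computable k (fun xs => bit (f xs) (g xs)).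
Proof.
move=> hf hg; apply: comp_eq (comp_const k 1).
exact: comp_digit (comp_const k 2) hf hg.
Qed.

Lemma exists_digits m K (f : nat -> nat) : (forall i, f i < m) ->
  exists2 q, q < m ^ K & forall i, i < K -> digit m q i = f i.
Proof.
elim: K f => [|K IH] f hf; first by exists 0.
have m_gt0 : 0 < m := leq_ltn_trans (leq0n _) (hf 0).
have [q lt_q hq] := IH (f \o succn) (fun i => hf i.+1).
exists (q * m + f 0) => [|[|i] lt_i].
- rewrite expnSr; apply: leq_trans (leq_mul lt_q (leqnn m)).
  by rewrite mulSn addnC ltn_add2r.
- by rewrite /digit expn0 divn1 modnMDl modn_small.
- rewrite -[f i.+1]/((f \o succn) i) -hq // /digit expnS divnMA divnMDl //.
  by rewrite (divn_small (hf 0)) addn0.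
Qed.

(** The truth values of an arbitrary [P] come from excluded middle, so sets defined by paths or
    configurations can serve as witnesses for bounded quantifiers. *)
Lemma exists_bits M (P : nat -> Prop) :
  exists2 u, u < 2 ^ M & forall i, i < M -> bit u i <-> P i.
Proof.
have [i|u lt_u hu] := @exists_digits 2 M (fun i => `[< P i >] : nat).
  exact: leq_b1.
by exists u => // i /hu; rewrite /bit => ->; rewrite eqb1; split => /asboolP.
Qed.

(** * A bounded formula for recurrence *)

Section Formula.

Variables (K c base : nat) (overlaps : seq (nat * nat * nat)).
Variables (inverses : seq (nat * nat)) (positions : seq nat).

Definition alphabet (x : nat) : nat := code_nth x 0.

(** A state [q * c + d] pairs a letter [q < m ^ K] with a direction [d < c]. *)
Definition n_states (x : nat) : nat := alphabet x ^ K * c.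

(** A triple [(d, i, j)] in [overlaps] records that position [i] seen from a vertex is position [j]
    seen from its neighbour in direction [d]. *)
Definition edge (m d q q' : nat) : bool :=
  all (fun e => (d == e.1.1) ==> (digit m q e.1.2 == digit m q' e.2)) overlaps.

Definition nonbacktracking (d d' : nat) : bool :=
  all (fun e => ~~ ((d == e.1) && (d' == e.2))) inverses.

(** Behind the alphabet size and the letter, the [k]-th forbidden pattern occupies the entries
    [3 * k + 2] to [3 * k + 4]. The loop bound overshoots; indices past the end are caught by the
    vanishing remainder. *)
Definition allowed (x q : nat) : bool :=
  all (fun k => (code_drop x (3 * k + 2) == 0) ||
    ~~ ((digit (alphabet x) q base == code_nth x (3 * k + 2)) &&
        (digit (alphabet x) q (nth 0 positions (code_nth x (3 * k + 4)))
           == code_nth x (3 * k + 3))))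
    (iota 0 x).

Definition marked (x q : nat) : bool :=
  digit (alphabet x) q base == code_nth x 1.

Definition extendable (x v : nat) : bool :=
  all (fun q => bit v q ==> (allowed x q &&
    all (fun d => has (fun q' => bit v q' && edge (alphabet x) d q q')
                    (iota 0 (alphabet x ^ K)))
      (iota 0 c)))
    (iota 0 (alphabet x ^ K)).

Definition step (x v s s' : nat) : bool :=
  (s' < n_states x) && (bit v (s' %/ c) &&
    (nonbacktracking (s %% c) (s' %% c) &&
     edge (alphabet x) (s' %% c) (s %/ c) (s' %/ c))).

Definition invariant_bits (x v u : nat) : bool :=
  all (fun s => all (fun s' => (bit u s && step x v s s') ==> bit u s')
                  (iota 0 (n_states x)))
    (iota 0 (n_states x)).

Definition reach (x v s s' : nat) : bool :=
  all (fun u => (invariant_bits x v u && bit u s) ==> bit u s')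
    (iota 0 (2 ^ n_states x)).

Definition reach_marked (x v s : nat) : bool :=
  all (fun u => (invariant_bits x v u && bit u s) ==>
    has (fun t => bit u t && marked x (t %/ c)) (iota 0 (n_states x)))
    (iota 0 (2 ^ n_states x)).

Definition recurrent_from (x v s : nat) : bool :=
  bit v (s %/ c) && has (fun s' => step x v s s' && (reach x v s' s &&
    (marked x (s %/ c) ||
     has (fun t => step x v s t && (~~ (t %% c == s' %% c) && reach_marked x v t))
       (iota 0 (n_states x)))))
    (iota 0 (n_states x)).

Definition recurrent (x : nat) : bool :=
  has (fun v => extendable x v && has (fun s => recurrent_from x v s)
                                    (iota 0 (n_states x)))
    (iota 0 (2 ^ (alphabet x ^ K))).

(** * Computability of the recurrence formula *)

Lemma comp_alphabet k f : computable k f -> computable k (fun xs => alphabet (f xs)).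
Proof. by move=> hf; apply: comp_code_nth hf (comp_const k 0). Qed.

Lemma comp_n_states k f : computable k f -> computable k (fun xs => n_states (f xs)).
Proof. by move=> hf; have := comp_alphabet hf; rewrite /n_states; solve_computable. Qed.

Lemma comp_edge k f g h i : computable k f -> computable k g -> computable k h -> computable k i ->
  computable k (fun xs => edge (f xs) (g xs) (h xs) (i xs)).
Proof.
by rewrite /edge; solve_computable; apply: comp_digit; solve_computable.
Qed.

Lemma comp_nonbacktracking k f g : computable k f -> computable k g ->
  computable k (fun xs => nonbacktracking (f xs) (g xs)).
Proof. by rewrite /nonbacktracking; solve_computable. Qed.

Lemma comp_allowed k f g : computable k f -> computable k g ->
  computable k (fun xs => allowed (f xs) (g xs)).
Proof.
move=> hf hg; have hm := comp_alphabet hf; rewrite /allowed; solve_computable;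
  try apply: comp_digit; try apply: comp_nth_const; try apply: comp_code_drop;
  try apply: comp_code_nth; solve_computable.
Qed.

Lemma comp_marked k f g : computable k f -> computable k g ->
  computable k (fun xs => marked (f xs) (g xs)).
Proof.
move=> hf hg; have hm := comp_alphabet hf; rewrite /marked; solve_computable.
  by apply: comp_digit; solve_computable.
by apply: comp_code_nth; solve_computable.
Qed.

Ltac formula_rule :=
  match goal with
  | |- computable _ (fun xs => alphabet _) => apply: comp_alphabet
  | |- computable _ (fun xs => n_states _) => apply: comp_n_states
  | |- computable _ (fun xs => _ %/ _) => apply: comp_div
  | |- computable _ (fun xs => _ %% _) => apply: comp_mod
  | |- computable _ (fun xs => nat_of_bool (bit _ _)) => apply: comp_bit
  | |- computable _ (fun xs => nat_of_bool (edge _ _ _ _)) => apply: comp_edge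
  | |- computable _ (fun xs => nat_of_bool (nonbacktracking _ _)) =>
      apply: comp_nonbacktracking
  | |- computable _ (fun xs => nat_of_bool (allowed _ _)) => apply: comp_allowed
  | |- computable _ (fun xs => nat_of_bool (marked _ _)) => apply: comp_marked
  end.
Ltac solve_formula := intros; repeat (first [computable_rule | formula_rule]).

Lemma comp_extendable k f g : computable k f -> computable k g ->
  computable k (fun xs => extendable (f xs) (g xs)).
Proof. by rewrite /extendable; solve_formula. Qed.

Lemma comp_step k f g h i : computable k f -> computable k g -> computable k h -> computable k i ->
  computable k (fun xs => step (f xs) (g xs) (h xs) (i xs)).
Proof. by rewrite /step; solve_formula. Qed.

Lemma comp_invariant_bits k f g h : computable k f -> computable k g -> computable k h ->
  computable k (fun xs => invariant_bits (f xs) (g xs) (h xs)).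
Proof.
by rewrite /invariant_bits; solve_formula; apply: comp_step; solve_formula.
Qed.

Lemma comp_reach k f g h i : computable k f -> computable k g -> computable k h -> computable k i ->
  computable k (fun xs => reach (f xs) (g xs) (h xs) (i xs)).
Proof.
by rewrite /reach; solve_formula; apply: comp_invariant_bits; solve_formula.
Qed.

Lemma comp_reach_marked k f g h : computable k f -> computable k g -> computable k h ->
  computable k (fun xs => reach_marked (f xs) (g xs) (h xs)).
Proof.
by rewrite /reach_marked; solve_formula; apply: comp_invariant_bits; solve_formula.
Qed.

Lemma comp_recurrent_from k f g h : computable k f -> computable k g -> computable k h ->
  computable k (fun xs => recurrent_from (f xs) (g xs) (h xs)).
Proof.
rewrite /recurrent_from; solve_formula.
- by apply: comp_step; solve_formula.
- by apply: comp_reach; solve_formula.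
- by apply: comp_step; solve_formula.
- by apply: comp_reach_marked; solve_formula.
Qed.

Lemma comp_recurrent k f : computable k f -> computable k (fun xs => recurrent (f xs)).
Proof.
rewrite /recurrent; solve_formula; first by apply: comp_extendable; solve_formula.
by apply: comp_recurrent_from; solve_formula.
Qed.

(** * Reachability through closed bitmasks *)

Lemma invariant_bits_path x v u s p :
  invariant_bits x v u -> s < n_states x -> bit u s -> path (step x v) s p ->
  last s p < n_states x /\ bit u (last s p).
Proof.
move=> inv; elim: p s => [//|t p IH] s lt_s us /= /andP[st].
have lt_t : t < n_states x by case/andP: st.
apply: IH => //; move/allP/(_ s): inv; rewrite mem_iota => /(_ lt_s).
by move/allP/(_ t); rewrite mem_iota us st => /(_ lt_t).
Qed.

(** The reachable states form the smallest closed set containing [s]; a quantifier over all closed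
    sets is exploited by instantiating it there. *)
Lemma exists_reachable_bits x v s : exists u,
  [/\ u < 2 ^ n_states x, invariant_bits x v u &
    forall t, t < n_states x ->
      bit u t <-> exists2 p, path (step x v) s p & last s p = t].
Proof.
have [u lt_u hu] := exists_bits (n_states x)
  (fun t => exists2 p, path (step x v) s p & last s p = t).
exists u; split=> //; apply/allP => a; rewrite mem_iota => /= lt_a.
apply/allP => b; rewrite mem_iota => /= lt_b.
apply/implyP => /andP[/(hu _ lt_a)[p hp ea] st]; apply/(hu _ lt_b).
by exists (rcons p b); rewrite ?last_rcons // rcons_path hp ea.
Qed.

Lemma reachP x v s s' : s < n_states x -> s' < n_states x ->
  reflect (exists2 p, path (step x v) s p & last s p = s') (reach x v s s').
Proof.
move=> lt_s lt_s'; apply: (iffP allP) => [hr|[p hp <-] u _].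
  have [u [lt_u inv hu]] := exists_reachable_bits x v s; apply/(hu _ lt_s').
  have us : bit u s by apply/(hu _ lt_s); exists [::].
  by have := hr u; rewrite mem_iota inv us => /(_ lt_u).
by apply/implyP => /andP[inv us]; case: (invariant_bits_path inv lt_s us hp).
Qed.

Lemma reach_markedP x v s : s < n_states x ->
  reflect (exists2 p, path (step x v) s p & marked x (last s p %/ c))
    (reach_marked x v s).
Proof.
move=> lt_s; apply: (iffP allP) => [hr|[p hp mp] u _].
  have [u [lt_u inv hu]] := exists_reachable_bits x v s.
  have us : bit u s by apply/(hu _ lt_s); exists [::].
  have := hr u; rewrite mem_iota inv us => /(_ lt_u) /hasP[t].
  rewrite mem_iota => /= lt_t /andP[/(hu _ lt_t)[p hp <-] mt].
  by exists p.
apply/implyP => /andP[inv us].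
have [lt_p up] := invariant_bits_path inv lt_s us hp.
by apply/hasP; exists (last s p); rewrite ?mem_iota ?up.
Qed.

End Formula.

(** * Recurrent labellings of the tree *)

Section RecurrentLabelling.

Variables (n : nat) (Q St : eqType).
Variables (V marked : pred Q) (E : flet n -> rel Q).
Variables (label : St -> Q) (dir : St -> flet n).

Definition tree_step : rel St := fun s s' =>
  [&& V (label s'), dir s' != flet_inv (dir s) & E (dir s') (label s) (label s')].

Definition forks (a : flet n) (r : seq St) : bool :=
  if r is t :: _ then dir t != a else true.

Definition recurrent_state (s : St) : Prop :=
  exists s' p r, [/\ V (label s), path tree_step s (s' :: p), last s' p = s,
    path tree_step s r & marked (label (last s r)) /\ forks (dir s') r].

Definition fletter (a : flet n) : free_group n := @FreeGroup n [:: a] isT.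

Definition fprod (w : seq (flet n)) : free_group n :=
  foldr (fun a g => (fletter a * g)%g) 1%g w.

Lemma fprod_cat (u v : seq (flet n)) : fprod (u ++ v) = (fprod u * fprod v)%g.
Proof. by elim: u => [|a u /= ->]; rewrite ?mul1g ?mulgA. Qed.

Lemma fprod_rcons (w : seq (flet n)) a : fprod (rcons w a) = (fprod w * fletter a)%g.
Proof. by rewrite -cats1 fprod_cat /= mulg1. Qed.

Lemma fword_fprod (w : seq (flet n)) : reduced w -> fword (fprod w) = w.
Proof.
elim: w => //= a w IH rw; rewrite -[RHS](fpush_cons rw) -{2}IH //.
exact: reduced_cons rw.
Qed.

Lemma fprod_fword (g : free_group n) : fprod (fword g) = g.
Proof. by apply: val_inj; rewrite /= fword_fprod ?fwordP. Qed.

Lemma fletter_inv (a : flet n) : fletter (flet_inv a) = (fletter a)^-1%g.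
Proof. exact: val_inj. Qed.

Lemma reduced_rcons (w : seq (flet n)) a : reduced w ->
  (if w is b :: w' then a != flet_inv (last b w') else true) ->
  reduced (rcons w a).
Proof. by case: w => //= b w rw ne; rewrite rcons_path rw. Qed.

Lemma reduced_rconsK (w : seq (flet n)) a : reduced (rcons w a) -> reduced w.
Proof. by case: w => //= b w; rewrite rcons_path => /andP[]. Qed.

Hypothesis E_sym : forall a q q', E a q q' -> E (flet_inv a) q' q.

(** Every edge of the Cayley tree lengthens a reduced word or reverses an edge that does; [E_sym]
    covers the second case. *)
Lemma labelling_edges (y : seq (flet n) -> Q) :
  (forall w a, reduced (rcons w a) -> E a (y w) (y (rcons w a))) ->
  forall (g : free_group n) a, E a (y (fword g)) (y (fword (g * fletter a)%g)).
Proof.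
move=> hy g a; rewrite -[g]fprod_fword; move: (fword g) (fwordP g) => w rw.
rewrite -fprod_rcons (fword_fprod rw).
case: (lastP w) rw => [|u b] rw; first by rewrite fword_fprod //; apply: hy.
have [eb|ne] := eqVneq a (flet_inv b).
  rewrite eb !fprod_rcons fletter_inv mulgK fword_fprod; last first.
    exact: reduced_rconsK rw.
  by apply: E_sym; apply: hy.
have rwa : reduced (rcons (rcons u b) a).
  apply: reduced_rcons => //; case: (u) ne => [|d v] //=.
  by rewrite last_rcons.
by rewrite fword_fprod //; apply: hy.
Qed.

(** * From a recurrent state to a labelling *)

Section Construction.

Variables (next : Q -> flet n -> Q).
Hypothesis nextP : forall q a, V q -> V (next q a) /\ E a q (next q a).

Variables (s s' : St) (p r : seq St).
Hypotheses (Vs : V (label s)) (path_p : path tree_step s (s' :: p)).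
Hypotheses (last_p : last s' p = s) (path_r : path tree_step s r).
Hypothesis fork : forks (dir s') r.

(* A memory state consists of the current label, the remainder of the path that
   is being followed, and whether that path leads back to s. *)
Definition memory : Type := (Q * seq St * bool)%type.

(** An empty remainder with flag [true] means being at [s], where the cycle or the branch [r] may
    start. A letter off the followed path leads to extension by [next] forever, as does completing
    [r]. *)
Definition follow (m : memory) (a : flet n) : memory :=
  let: (q, l, b) := m in
  let stray := (next q a, [::], false) in
  match l with
  | t :: l' => if a == dir t then (label t, l', b) else stray
  | [::] =>
    if ~~ b then stray
    else if a == dir s' then (label s', p, true)
    else if r is t :: r' then
      if a == dir t then (label t, r', false) else stray
    else stray
  end.

Definition run (w : seq (flet n)) : memory := foldl follow (label s, [::], true) w.

(* The edges of the path depend on its starting state only through the label,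
   except for the backtracking condition, which is why [t0] is existential. *)
Definition good_memory (m : memory) : Prop :=
  let: (q, l, b) := m in V q /\
  (l = [::] /\ ~~ b \/
   exists t0, [/\ label t0 = q, path tree_step t0 l & b -> last t0 l = s]).

Lemma follow_good m a : good_memory m ->
  good_memory (follow m a) /\ E a m.1.1 (follow m a).1.1.
Proof.
case: m => [[q l] b] [Vq good_l]; have [Vn En] := nextP a Vq.
have stray_ok : good_memory (next q a, [::], false) /\ E a q (next q a).
  by split=> //; split=> //; left.
case: good_l => [[-> /negPf->] //|[t0 [et0 path_l last_l]]].
case: l path_l last_l => [|t l] /= path_l last_l; last first.
  case: eqP => // ->; case/andP: path_l => /and3P[Vt _ Et] path_l.
  by rewrite -et0; split=> //; split=> //; right; exists t.
case: b last_l => //= last_l.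
(* A path back to [s] has just been exhausted, so [t0] is [s] and the first edges of the cycle and
   of the branch are available. *)
have eq_s : q = label s by rewrite -et0 last_l.
case: eqP => [->|_].
  case/andP: path_p => /and3P[Vs' _ Es'] path_p'.
  by rewrite eq_s; split=> //; split=> //; right; exists s'.
case: (r) path_r => [|t r'] //= /andP[/and3P[Vt _ Et] path_r'].
by case: eqP => // ->; rewrite eq_s; split=> //; split=> //; right; exists t.
Qed.

Lemma run_good w : good_memory (run w).
Proof.
elim/last_ind: w => [|w a IH]; first by split=> //; right; exists s.
by rewrite /run foldl_rcons; case: (follow_good a IH).
Qed.

Lemma run_edge w a : E a (run w).1.1 (run (rcons w a)).1.1.
Proof. by rewrite /run foldl_rcons; case: (follow_good a (run_good w)). Qed.

Lemma follow_path q l b :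
  foldl follow (q, l, b) (map dir l) = (last q (map label l), [::], b).
Proof. by elim: l q => //= t l IH q; rewrite eqxx IH. Qed.

(** A full turn of the cycle restores the initial memory. *)
Lemma run_cycle k w :
  run (flatten (nseq k (map dir (s' :: p))) ++ w) = run w.
Proof.
elim: k => //= k IH; rewrite -catA /run /= eqxx foldl_cat follow_path.
by rewrite last_map last_p; apply: IH.
Qed.

(** At [s] the cycle is tried first; [fork] ensures that the first letter of [r] is not taken for
    that of the cycle. *)
Lemma run_branch : (run (map dir r)).1.1 = label (last s r).
Proof.
rewrite /run; move: fork; case er: {1 2 3}r => //= [t r'] ne.
by rewrite (negPf ne) er eqxx follow_path last_map.
Qed.

Definition marked_word k : seq (flet n) :=
  flatten (nseq k (map dir (s' :: p))) ++ map dir r.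

(** Each step forbids backtracking relative to the direction stored in its source, and this includes
    the passages through [s] where turns and branch are glued. *)
Lemma reduced_marked_word k : reduced (marked_word k).
Proof.
have path_k : path tree_step s (flatten (nseq k (s' :: p)) ++ r).
  elim: k => [//|k IH]; rewrite -[flatten _]/((s' :: p) ++ flatten (nseq k (s' :: p))).
  by rewrite -catA cat_path path_p [last _ _]/= last_p.
have : path (fun a b => b != flet_inv a) (dir s)
  (map dir (flatten (nseq k (s' :: p)) ++ r)).
  by rewrite path_map; apply: sub_path path_k => a b /and3P[].
rewrite map_cat map_flatten map_nseq; exact: path_sorted.
Qed.

Lemma marked_word_inj : injective marked_word.
Proof.
move=> j k /(congr1 size); rewrite !size_cat => /addIn.
have size_flat i : size (flatten (nseq i (map dir (s' :: p)))) = i * (size p).+1.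
  by elim: i => //= i IH; rewrite size_cat IH size_map.
by rewrite !size_flat => /eqP; rewrite eqn_pmul2r // => /eqP.
Qed.

Hypothesis marked_r : marked (label (last s r)).

Lemma run_recurrent : infinite_set [set g | marked (run (fword g)).1.1].
Proof.
pose f k := FreeGroup (reduced_marked_word k).
have f_inj : injective f by move=> j k [] /marked_word_inj.
move=> /(@finite_preimage _ _ _ f (in2W f_inj)).
apply: sub_infinite_set infinite_nat => k _ /=.
by rewrite run_cycle run_branch.
Qed.

End Construction.

Lemma recurrent_state_labelling (next : Q -> flet n -> Q) (s : St) :
  (forall q a, V q -> V (next q a) /\ E a q (next q a)) ->
  recurrent_state s ->
  exists y : free_group n -> Q,
    [/\ forall g, V (y g), forall g a, E a (y g) (y (g * fletter a)%g) &
        infinite_set [set g | marked (y g)]].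
Proof.
move=> nextP [s' [p [r [Vs path_p last_p path_r [marked_r fork]]]]].
exists (fun g => (run next s s' p r (fword g)).1.1); split.
- move=> g; have := run_good nextP Vs path_p last_p path_r (fword g).
  by case: (run _ _ _ _ _ _) => [[q l] b] [].
- apply: (labelling_edges (y := fun w => (run next s s' p r w).1.1)) => w a _.
  exact: (run_edge nextP Vs path_p last_p path_r).
- exact: (run_recurrent path_p last_p path_r fork marked_r).
Qed.

(** * From a labelling to a recurrent state *)

Section FromLabelling.

Variables (mk : Q -> flet n -> St).
Hypotheses (label_mk : forall q a, label (mk q a) = q).
Hypotheses (dir_mk : forall q a, dir (mk q a) = a).
Variables (y : free_group n -> Q) (states : seq St) (a0 : flet n).
Hypotheses (y_V : forall g, V (y g)).
Hypotheses (y_E : forall g a, E a (y g) (y (g * fletter a)%g)).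
Hypotheses (mk_states : forall g a, mk (y g) a \in states).
Hypothesis y_inf : infinite_set [set g | marked (y g)].

Definition infinite_below (w : seq (flet n)) : Prop :=
  infinite_set [set g | marked (y g) /\ prefix w (fword g)].

(** The empty word has no last letter and gets the arbitrary direction [a0]; for this reason paths
    are only taken from nonempty words. *)
Definition word_state (w : seq (flet n)) : St := mk (y (fprod w)) (last a0 w).

(** As in König's lemma: a marked element below [w] is [w] itself or lies below one of finitely many
    extensions. *)
Lemma infinite_belowS w : infinite_below w -> exists a, infinite_below (rcons w a).
Proof.
move=> inf_w; apply: contrapT => none; apply: inf_w.
have fin : finite_set (fprod w |` \bigcup_(a in [set: flet n])
    [set g | marked (y g) /\ prefix (rcons w a) (fword g)])%classic.
  rewrite finite_setU; split; first exact: finite_set1.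
  apply: bigcup_finite => [|a _]; first exact: finite_finset.
  by apply: contrapT => inf_a; apply: none; exists a.
apply: sub_finite_set fin => g [mg /prefixP[[|a u] eg]].
  by left; rewrite /= -[g]fprod_fword eg cats0.
by right; exists a => //; split=> //; rewrite eg -cat_rcons prefix_prefix.
Qed.

Lemma reduced_catl (u v : seq (flet n)) : reduced (u ++ v) -> reduced u.
Proof.
by elim/last_ind: v => [|v a IH]; rewrite ?cats0 // -rcons_cat => /reduced_rconsK.
Qed.

Lemma infinite_below_reduced w : infinite_below w -> reduced w.
Proof.
move=> /infinite_setN0[g [_ /prefixP[u eg]]].
by apply: (@reduced_catl w u); rewrite -eg fwordP.
Qed.

Lemma step_word_state w a : w != [::] -> reduced (rcons w a) ->
  tree_step (word_state w) (word_state (rcons w a)).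
Proof.
case: w => // b w _; rewrite /tree_step !label_mk !dir_mk y_V last_rcons.
by rewrite fprod_rcons y_E /= rcons_path => /andP[_ ->].
Qed.

Lemma path_word_state w a u : w != [::] -> reduced (w ++ a :: u) ->
  exists2 p, path tree_step (word_state w) (word_state (rcons w a) :: p) &
    last (word_state (rcons w a)) p = word_state (w ++ a :: u).
Proof.
elim: u w a => [|b u IH] w a w_n0 rw.
  by exists [::]; rewrite ?cats1 //= step_word_state // -cats1.
have step_wa : tree_step (word_state w) (word_state (rcons w a)).
  apply: step_word_state => //; rewrite -cat_rcons in rw.
  exact: reduced_catl rw.
have [|| p path_p last_p] := IH (rcons w a) b; rewrite ?cat_rcons //.
  by case: (w).
exists (word_state (rcons (rcons w a) b) :: p); last by rewrite /= last_p cat_rcons.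
by apply/andP; split.
Qed.

Definition forking (w : seq (flet n)) (a : flet n) : Prop :=
  [/\ w != [::], infinite_below (rcons w a) &
    exists r, [/\ path tree_step (word_state w) r,
      marked (label (last (word_state w) r)) & forks a r]].

(** Descend towards a marked element while the subtree below remains infinite. If the descent
    reaches it, the empty branch works; otherwise it leaves the infinite part at a letter [b], and
    any infinite direction differs from [b]. *)
Lemma exists_forking w : w != [::] -> infinite_below w ->
  exists u a, forking (w ++ u) a.
Proof.
move=> w_n0 inf_w; have [g [mg /prefixP[u eg]]] := infinite_setN0 inf_w.
elim: u w w_n0 inf_w eg => [|b u IH] w w_n0 inf_w eg.
  have [a inf_a] := infinite_belowS inf_w.
  exists [::], a; rewrite cats0; split=> //; exists [::]; split=> //=.
  by rewrite label_mk -[w]cats0 -eg fprod_fword.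
have [inf_b|fin_b] := pselect (infinite_below (rcons w b)).
  have [|||v [a fork]] := IH (rcons w b); rewrite ?cat_rcons //.
    by case: (w).
  by exists (b :: v), a; rewrite -cat_rcons.
have [a inf_a] := infinite_belowS inf_w.
exists [::], a; rewrite cats0; split=> //.
have [|p path_p last_p] := @path_word_state w b u w_n0; first by rewrite -eg fwordP.
exists (word_state (rcons w b) :: p); split=> //.
  by rewrite [last _ _]/= last_p label_mk -eg fprod_fword.
by rewrite /= dir_mk last_rcons; apply/eqP => eb; apply: fin_b; rewrite eb.
Qed.

Lemma labelling_recurrent_state : exists s, recurrent_state s.
Proof.
(* From a forking vertex one proceeds in its infinite direction to a strictly longer forking vertex;
   iterating [f] yields a ray of them. *)
have /choice[f hf] : forall z, exists z', forking z.1 z.2 ->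
    forking z'.1 z'.2 /\ exists u, z'.1 = z.1 ++ z.2 :: u.
  move=> [w a] /=.
  have [fork|nfork] := pselect (forking w a); last by exists (w, a).
  have [_ inf_a _] := fork.
  have [|u [b fork']] := exists_forking _ inf_a; first by case: (w).
  exists (rcons w a ++ u, b) => _; split=> //.
  by exists u; rewrite cat_rcons.
have [z0 fork0] : exists z, forking z.1 z.2.
  have [|a inf_a] := @infinite_belowS [::].
    by apply: sub_infinite_set y_inf => g mg; split=> //; apply: prefix0s.
  have [//|u [b fork]] := exists_forking _ inf_a.
  by exists (rcons [::] a ++ u, b).
pose z i := iter i f z0.
have fork_z i : forking (z i).1 (z i).2.
  by elim: i => //= i /hf[].
have extends i k : exists u, (z (i + k).+1).1 = (z i).1 ++ (z i).2 :: u.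
  elim: k => [|k [u eu]]; first by rewrite addn0; case: (hf _ (fork_z i)).
  have [_ [v ev]] := hf _ (fork_z (i + k).+1).
  exists (u ++ (z (i + k).+1).2 :: v).
  by rewrite addnS [z _.+1]/= ev eu -catA.
(* Pigeonhole: one more vertex of the ray than there are states forces two vertices with equal
   states. *)
pose sz := [seq word_state (z i).1 | i <- iota 0 (size states).+1].
have : ~~ uniq sz.
  apply/negP => /uniq_leq_size lt_sz; have := lt_sz states.
  rewrite size_map size_iota ltnn => absurd; suff : false by [].
  by apply: absurd => s /mapP[i _ ->]; apply: mk_states.
case/(uniqPn (mk (y 1%g) a0)) => i [j [lt_ij]].
rewrite size_map size_iota => lt_j.
have lt_i := ltn_trans lt_ij lt_j.
rewrite !(nth_map 0) ?size_iota // !nth_iota // !add0n => eq_ij.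
have [u] := extends i (j - i.+1).
rewrite -addSn subnKC // => ej.
have [w_n0 inf_a [r [path_r marked_r fork_r]]] := fork_z i.
have [_ /infinite_belowS _ _] := fork_z j.
have rj : reduced (z j).1.
  have [_ /infinite_below_reduced + _] := fork_z j; exact: reduced_rconsK.
have [|p path_p last_p] := @path_word_state (z i).1 (z i).2 u w_n0.
  by rewrite -ej.
(* The cycle is the segment of the ray from [i] to [j]; the branch is the fork at [i], which avoids
   the direction of the ray. *)
exists (word_state (z i).1), (word_state (rcons (z i).1 (z i).2)), p, r.
split=> //; first by rewrite label_mk.
  by rewrite last_p -ej.
by split=> //; rewrite dir_mk last_rcons.
Qed.

End FromLabelling.
End RecurrentLabelling.

(** * From instances to labellings *)

Lemma digit_lt m q i : 0 < m -> digit m q i < m.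
Proof. exact: ltn_pmod. Qed.

Lemma bit_lt u N i : u < 2 ^ N -> bit u i -> i < N.
Proof.
move=> lt_u ui; rewrite -(ltn_exp2l _ _ (isT : 1 < 2)).
apply: leq_ltn_trans lt_u; rewrite leqNgt; apply/negP => lt_ui.
by move: ui; rewrite /bit /digit divn_small // mod0n.
Qed.

(** [W] collects all suffixes of the words in [S]. Closure under suffixes allows the value at
    [g * w] to be traced from [g] one letter of [w] at a time. *)
Lemma exists_suffix_closed n (S : seq (free_group n)) :
  exists W : seq (free_group n), [/\ 1%g \in W, {subset S <= W} &
    forall a u, reduced (a :: u) -> fprod (a :: u) \in W -> fprod u \in W].
Proof.
pose suf (s : free_group n) :=
  [seq fprod (drop i (fword s)) | i <- iota 0 (size (fword s)).+1].
have mem_suf (s : free_group n) i : s \in S ->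
    fprod (drop i (fword s)) \in 1%g :: flatten (map suf S).
  move=> sS; rewrite inE; case: (ltnP i (size (fword s))) => lt_i.
    apply/orP; right; apply/flatten_mapP; exists s => //.
    by apply/mapP; exists i; first by rewrite mem_iota /= add0n ltnS ltnW.
  by rewrite drop_oversize // eqxx.
exists (1%g :: flatten (map suf S)); split=> [|s sS|a u rau].
- exact: mem_head.
- by have := mem_suf s 0 sS; rewrite drop0 fprod_fword.
rewrite inE => /orP[/eqP/(congr1 (@fword n))|].
  by rewrite fword_fprod.
case/flatten_mapP => s sS /mapP[i _ /(congr1 (@fword n))].
rewrite fword_fprod // fword_fprod; last exact: drop_sorted (fwordP s).
move=> eau; have -> : u = drop i.+1 (fword s).
  by rewrite -addn1 addnC -drop_drop -eau /= drop0.
exact: mem_suf.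
Qed.

(** * Patterns on [W] and their numerical codes *)

Section Encoding.

Variables (n : nat) (n_gt0 : 0 < n) (S W : seq (free_group n)).
Hypotheses (W1 : 1%g \in W) (SW : {subset S <= W}).
Hypothesis W_suffix : forall a u,
  reduced (a :: u) -> fprod (a :: u) \in W -> fprod u \in W.

Let K := size W.
Let c := #|{: flet n}|.
Let rank (a : flet n) : nat := enum_rank a.
Let letter_of (d : nat) : flet n :=
  nth (Ordinal n_gt0, false) (enum {: flet n}) d.

(** When [w = a * w'], the vertex [g * w] seen from [g] is [(g * a) * w'] seen from the neighbour
    [g * a]. *)
Definition overlap_triples : seq (nat * nat * nat) :=
  [seq (rank z.1.1, index z.1.2 W, index z.2 W) |
    z <- [seq z <- [seq (p, w') | p <- [seq (a, w) | a <- enum {: flet n}, w <- W],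
                                  w' <- W]
         | z.1.2 == (fletter z.1.1 * z.2)%g]].

Definition inverse_pairs : seq (nat * nat) :=
  [seq (rank a, rank (flet_inv a)) | a <- enum {: flet n}].

Definition generator_positions : seq nat := [seq index s W | s <- S].

Local Notation Edge := (edge overlap_triples).
Local Notation Nonback := (nonbacktracking inverse_pairs).
Local Notation Allowed := (allowed (index 1%g W) generator_positions).
Local Notation Marked := (marked (index 1%g W)).
Local Notation Step := (step K c overlap_triples inverse_pairs).

Lemma rank_lt a : rank a < c. Proof. exact: ltn_ord. Qed.

Lemma c_gt0 : 0 < c.
Proof. by apply: leq_ltn_trans (rank_lt (Ordinal n_gt0, false)). Qed.

Lemma rankK a : letter_of (rank a) = a.
Proof. exact: nth_enum_rank. Qed.

Lemma letter_ofK d : d < c -> rank (letter_of d) = d.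
Proof.
move=> lt_d; rewrite /rank /letter_of.
have -> : d = Ordinal lt_d :> nat by [].
by rewrite -(enum_val_nth (Ordinal n_gt0, false) (Ordinal lt_d)) enum_valK.
Qed.

Lemma edgeP m a q q' : reflect
  (forall w w', w \in W -> w' \in W -> w = (fletter a * w')%g ->
     digit m q (index w W) = digit m q' (index w' W))
  (Edge m (rank a) q q').
Proof.
apply: (iffP allP) => [h w w' wW w'W ew|h e /mapP[[[b w] w']]].
  have /h /= : (rank a, index w W, index w' W) \in overlap_triples.
    apply/mapP; exists (a, w, w') => //; rewrite mem_filter /= ew eqxx /= -ew.
    apply/allpairsP; exists ((a, w), w'); split=> //.
    by apply/allpairsP; exists (a, w); rewrite mem_enum.
  by rewrite eqxx => /eqP.
rewrite mem_filter => /andP[/eqP /= ew /allpairsP[[z z'] /= [+ z'W]]].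
case/allpairsP => [[b' v] /= [_ vW ->]] [eb ewv ez'] ->; apply/implyP => /eqP /=.
move=> /ord_inj/enum_rank_inj eab; apply/eqP; apply: h; rewrite ?eab //.
  by rewrite ewv.
by rewrite ez'.
Qed.

Lemma edge_sym m a q q' :
  Edge m (rank a) q q' -> Edge m (rank (flet_inv a)) q' q.
Proof.
move=> /edgeP h; apply/edgeP => w w' wW w'W ew; apply/esym/h => //.
by rewrite ew fletter_inv mulVKg.
Qed.

Lemma nonbacktrackingE a b : Nonback (rank a) (rank b) = (b != flet_inv a).
Proof.
apply/allP/idP => [h|ne e /mapP[a' _ ->]].
  apply/eqP => eb; have /h /= : (rank a, rank b) \in inverse_pairs.
    by apply/mapP; exists a; rewrite ?mem_enum // eb.
  by rewrite !eqxx.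
apply: contra ne => /= /andP[/eqP/ord_inj/enum_rank_inj -> /eqP].
by move/ord_inj/enum_rank_inj ->.
Qed.

Let label (s : nat) : nat := s %/ c.
Let dir (s : nat) : flet n := letter_of (s %% c).
Let mk (q : nat) (a : flet n) : nat := q * c + rank a.

Lemma label_mk q a : label (mk q a) = q.
Proof. by rewrite /label divnMDl ?c_gt0 // divn_small ?addn0 // rank_lt. Qed.

Lemma dir_mk q a : dir (mk q a) = a.
Proof. by rewrite /dir modnMDl modn_small ?rankK // rank_lt. Qed.

Lemma rank_dir s : rank (dir s) = s %% c.
Proof. by rewrite letter_ofK // ltn_pmod // c_gt0. Qed.

Section Instance.

Variables (m x v : nat).
Hypotheses (alphabet_x : alphabet x = m) (lt_v : v < 2 ^ (m ^ K)).

Let E (a : flet n) : rel nat := Edge m (rank a).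

Lemma lt_n_states s : bit v (label s) -> s < n_states K c x.
Proof. by move=> /(bit_lt lt_v); rewrite /n_states alphabet_x -ltn_divLR ?c_gt0. Qed.

Lemma stepE : Step x v =2 tree_step (bit v) E label dir.
Proof.
move=> s s'; rewrite /step /tree_step -!rank_dir nonbacktrackingE alphabet_x.
by apply: andb_idl => /and3P[/lt_n_states].
Qed.

Lemma recurrent_fromP s : s < n_states K c x ->
  recurrent_from K c (index 1%g W) overlap_triples inverse_pairs x v s <->
  recurrent_state (bit v) (Marked x) E label dir s.
Proof.
have Step_lt a b : Step x v a b -> b < n_states K c x by case/andP.
move=> lt_s; split.
  case/andP=> vs /hasP[s' _ /and3P[ss' /(reachP _ _ _ (Step_lt _ _ ss') lt_s)]].
  case=> p path_p last_p fork; exists s', p.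
  have Pp : path (tree_step (bit v) E label dir) s (s' :: p).
    by rewrite -(eq_path stepE) /= ss'.
  case/orP: fork => [ms|/hasP[t _ /and3P[st ne]]].
    by exists [::]; split.
  case/(reach_markedP _ _ _ _ (Step_lt _ _ st)) => r path_r mr.
  exists (t :: r); split=> //; first by rewrite -(eq_path stepE) /= st.
  split=> //; apply: contra ne => /eqP et.
  by rewrite -!rank_dir et.
case=> s' [p [r [vs path_p last_p path_r [mr fork]]]].
apply/andP; split=> //; move: path_p; rewrite -(eq_path stepE) => /andP[ss' path_p].
apply/hasP; exists s'; first by rewrite mem_iota (Step_lt _ _ ss').
rewrite ss' /=; apply/andP; split.
  by apply/(reachP _ _ _ (Step_lt _ _ ss') lt_s); exists p.
case: r path_r mr fork => [|t r]; first by move=> _ /= ->.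
rewrite -(eq_path stepE) => /andP[st path_r] mr fork.
apply/orP; right; apply/hasP; exists t; first by rewrite mem_iota (Step_lt _ _ st).
rewrite st /=; apply/andP; split.
  by apply: contra fork => /eqP et; rewrite /dir et.
by apply/(reach_markedP _ _ _ _ (Step_lt _ _ st)); exists r.
Qed.

End Instance.

(** * Equivalence of the formula with the recurrent domino problem *)

Section Equivalence.

Variable I : rdp_instance S.

Let m := alphabet_size I.
Let x := rdp_code I.
Let E (a : flet n) : rel nat := Edge m (rank a).

Lemma m_gt0 : 0 < m.
Proof. exact: leq_ltn_trans (leq0n _) (ltn_ord (letter I)). Qed.

Lemma alphabetE : alphabet x = m.
Proof. by rewrite /alphabet code_nthE. Qed.

Lemma nth_flatten_triples (T : Type) (f g h : T -> nat) p0 (F : seq T) k :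
  k < size F ->
  let L := flatten [seq [:: f p; g p; h p] | p <- F] in
  let p := nth p0 F k in
  [/\ nth 0 L (3 * k) = f p, nth 0 L (3 * k).+1 = g p
    & nth 0 L (3 * k).+2 = h p].
Proof.
elim: F k => // p F IH [|k] lt_k L q //; rewrite /L mulnS /=.
exact: IH lt_k.
Qed.

Lemma size_flatten_triples (T : Type) (f g h : T -> nat) (F : seq T) :
  size (flatten [seq [:: f p; g p; h p] | p <- F]) = 3 * size F.
Proof. by elim: F => //= p F ->; rewrite mulnS. Qed.

Lemma allowedP q : reflect
  (forall p, p \in forbidden I ->
     ~ (digit m q (index 1%g W) = p.1.1 /\
        digit m q (index (ssval p.2) W) = p.1.2))
  (Allowed x q).
Proof.
pose F := forbidden I.
set L := flatten [seq [:: nat_of_ord p.1.1; nat_of_ord p.1.2; index (ssval p.2) S]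
                 | p <- F].
have xE : x = CodeSeq.code [:: m, nat_of_ord (letter I) & L] by [].
have sizeL : size L = 3 * size F by exact: size_flatten_triples.
(* The instance stores positions in [S], whereas digits are indexed by positions in [W]. *)
have posE (p : nn_pattern S 'I_m) :
    nth 0 (generator_positions) (index (ssval p.2) S) = index (ssval p.2) W.
  by rewrite (nth_map (ssval p.2)) ?index_mem ?ssvalP // nth_index ?ssvalP.
apply: (iffP allP) => [h p pF [e1 e2]|h k _].
  have lt_k : index p F < size F by rewrite index_mem.
  (* The loop bound [x] must exceed the index of every forbidden pattern. *)
  have le_x : size F <= x.
    rewrite xE; apply: leq_trans (size_code _); rewrite /= sizeL.
    by rewrite -addn2 (leq_trans (leq_pmull _ (isT : 0 < 3))) // leq_addr.
  have [n1 n2 n3] := nth_flatten_triples (fun p : nn_pattern S 'I_m => nat_of_ord p.1.1)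
    (fun p => nat_of_ord p.1.2) (fun p => index (ssval p.2) S) p lt_k.
  have := h (index p F); rewrite mem_iota (leq_trans lt_k le_x) => /(_ isT).
  rewrite alphabetE xE code_drop_eq0 !code_nthE addn2 addn3 addn4 /= -/L.
  rewrite n1 n2 n3 nth_index // posE e1 e2 !eqxx /= orbF.
  by rewrite !ltnS sizeL leq_pmul2l // leqNgt lt_k.
rewrite alphabetE xE code_drop_eq0 !code_nthE.
case: leqP => //= lt_k; have {}lt_k : k < size F.
  rewrite -(ltn_pmul2l (isT : 0 < 3)) -sizeL -(ltn_add2r 2) [size L + 2]addn2.
  exact: lt_k.
have p0 : nn_pattern S 'I_m.
  by case: (F) lt_k.
have [n1 n2 n3] := nth_flatten_triples (fun p : nn_pattern S 'I_m => nat_of_ord p.1.1)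
    (fun p => nat_of_ord p.1.2) (fun p => index (ssval p.2) S) p0 lt_k.
rewrite addn2 addn3 addn4 /= -/L n1 n2 n3 posE.
apply/negP => /andP[/eqP e1 /eqP e2].
by case: (h (nth p0 F k)); rewrite ?mem_nth.
Qed.

Lemma markedE q : Marked x q = (digit m q (index 1%g W) == letter I).
Proof. by rewrite /marked alphabetE code_nthE. Qed.

Lemma rdp_recurrent : rdp I ->
  recurrent K c (index 1%g W) overlap_triples inverse_pairs generator_positions x.
Proof.
case=> z z_ok z_inf.
(* [y g] codes the restriction of [z] to the translate of [W] by [g]. *)
have /choice[y hy] : forall g, exists q, q < m ^ K /\
    forall w, w \in W -> digit m q (index w W) = z (g * w)%g.
  move=> g; have [i|q lt_q hq] := @exists_digits m K (fun i => z (g * nth 1 W i)%g).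
    exact: ltn_ord.
  by exists q; split=> // w wW; rewrite hq ?index_mem // nth_index.
have y_lt g : y g < m ^ K by case: (hy g).
have y_digit g w : w \in W -> digit m (y g) (index w W) = z (g * w)%g.
  by case: (hy g) => _; apply.
have y_E g a : E a (y g) (y (g * fletter a)%g).
  by apply/edgeP => w w' wW w'W ew; rewrite !y_digit // ew mulgA.
(* The set of letters consists of the patterns occurring in [z]; each extends in every direction
   because its neighbours occur as well. *)
have [v lt_v hv] := exists_bits (m ^ K) (fun q => exists g, y g = q).
have y_V g : bit v (y g) by apply/hv => //; exists g.
have mk_lt g a : mk (y g) a \in iota 0 (n_states K c x).
  by rewrite mem_iota (lt_n_states alphabetE lt_v) ?label_mk.
have y_inf : infinite_set [set g | Marked x (y g)]%classic.
  apply: sub_infinite_set z_inf => g /= zg.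
  by rewrite markedE y_digit // mulg1 zg.
have [s rec_s] := labelling_recurrent_state (E := E) label_mk dir_mk
  (Ordinal n_gt0, false) y_V y_E mk_lt y_inf.
have lt_s : s < n_states K c x.
  by case: rec_s => s' [p [r [Vs _ _ _ _]]]; apply: (lt_n_states alphabetE lt_v).
apply/hasP; exists v; first by rewrite mem_iota alphabetE.
apply/andP; split; last first.
  apply/hasP; exists s; first by rewrite mem_iota.
  exact/(recurrent_fromP alphabetE lt_v).
apply/allP => q; rewrite mem_iota alphabetE => lt_q; apply/implyP => /(hv _ lt_q).
case=> g <-; apply/andP; split.
  apply/allowedP => p pF; rewrite (y_digit _ _ W1) y_digit ?SW ?ssvalP // mulg1.
  move=> -[e1 e2].
  case: (z_ok p pF); move: p pF e1 e2 => [[a b] t] /= _ e1 e2.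
  by exists g; split; apply: val_inj.
apply/allP => d; rewrite mem_iota => lt_d; apply/hasP.
exists (y (g * fletter (letter_of d))%g); first by rewrite mem_iota y_lt.
by rewrite y_V -(letter_ofK lt_d) rankK; apply: y_E.
Qed.

Lemma recurrent_rdp :
  recurrent K c (index 1%g W) overlap_triples inverse_pairs generator_positions x ->
  rdp I.
Proof.
case/hasP => v; rewrite mem_iota alphabetE => /= lt_v /andP[ext_v /hasP[s]].
rewrite mem_iota => /= lt_s /(recurrent_fromP alphabetE lt_v lt_s) rec_s.
have extP q : bit v q -> Allowed x q /\
    forall a, exists q', bit v q' /\ E a q q'.
  move=> vq; have lt_q := bit_lt lt_v vq.
  move/allP/(_ q): ext_v; rewrite mem_iota alphabetE vq => /(_ lt_q)/andP[-> ext_q].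
  split=> // a; move/allP/(_ (rank a)): ext_q; rewrite mem_iota => /(_ (rank_lt a)).
  by case/hasP => q' _ /andP[]; exists q'.
have /choice[next nextP] : forall qa : nat * flet n, exists q',
    bit v qa.1 -> bit v q' /\ E qa.2 qa.1 q'.
  move=> [q a] /=; have [vq|nvq] := boolP (bit v q); last by exists 0.
  by have [_ /(_ a)[q' hq']] := extP _ vq; exists q'.
have [y [y_V y_E y_inf]] := recurrent_state_labelling (@edge_sym m)
  (fun q a => nextP (q, a)) rec_s.
(* By induction along [w], the pattern at [g] agrees with the values at the identity position of the
   patterns around [g]. *)
have y_digit (g w : free_group n) : w \in W ->
    digit m (y g) (index w W) = digit m (y (g * w)%g) (index 1%g W).
  rewrite -[w]fprod_fword; move: (fword w) (fwordP w) => u.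
  elim: u g => [|a u IH] g ru uW; first by rewrite /= mulg1.
  have uW' := W_suffix ru uW.
  have /edgeP := y_E g a; move/(_ _ _ uW uW' erefl) => ->.
  by rewrite IH ?(reduced_cons ru) // -mulgA.
(* The configuration reads off, at each [g], the identity position of the pattern [y g]. *)
exists (fun g => Ordinal (digit_lt (y g) (index 1%g W) m_gt0)).
  move=> [[a b] t] pF [g [/(congr1 val) /= e1 /(congr1 val) /= e2]].
  have [/allowedP/(_ _ pF) + _] := extP _ (y_V g); apply => /=.
  by rewrite (y_digit _ (ssval t)) ?SW ?ssvalP.
apply: sub_infinite_set y_inf => g /=; rewrite markedE => /eqP eg.
exact: val_inj.
Qed.

End Equivalence.
End Encoding.

Theorem theorem15 (n : nat) (hn : (1 <= n)%N)
    (S : seq (free_group n)) (hS : generates S) :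
  rdp_decidable S.
Proof.
have [W [W1 SW W_suffix]] := exists_suffix_closed S.
(* The tables depend on [n], [S] and [W] only, so they are constants of one program whose sole
   argument is the code of the instance. *)
have [p hp] := comp_recurrent (size W) #|{: flet n}| (index 1%g W)
  (overlap_triples W) (inverse_pairs n) (generator_positions S W) (comp_nth 1 0).
exists p => I; have := hp [:: rdp_code I] erefl => /=.
case: (boolP (recurrent _ _ _ _ _ _ _)) => [rec_I|nrec_I] ev; split=> // rdp_I.
  by case: rdp_I; apply: (recurrent_rdp hn SW W_suffix).
by case/negP: nrec_I; apply: (rdp_recurrent hn W1 SW).
Qed.
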